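(* Let $d\in\mathbb{N}$. For any pair of sequences of positive integers $b=b(n)\to\infty$ and $k=k(n)\to\infty$ (as $n\to\infty$) satisfying $$\frac{n}{bk\log(b)+k^d\log(k^d)}\to\infty,$$ there exists an estimator $V_n\in\widetilde{\mathcal{H}}_{d,b}^k$ such that, for all $\varepsilon>0$, $$\sup_{p\in\mathcal{D}_d}P\left(\|V_n-p\|_1>3\min_{q\in\widetilde{\mathcal{H}}_{d,b}^k}\|p-q\|_1+\varepsilon\right)\to 0\quad (n\to\infty),$$ where $V_n$ is a function of $X_1,\ldots,X_n\overset{iid}{\sim}p$.
   Context: $\mathbb{N}$ denotes the positive integers and $[b]=\{1,\ldots,b\}$. $\mathcal{D}_d$ is the set of all probability densities on $[0,1)^d$ (with respect to $d$-dimensional Lebesgue measure); $\|\cdot\|_1$ is the $L^1$ norm. $\mathcal{T}_{d,k}$ is the set of order-$d$ tensors $W\in\mathbb{R}^{k\times\cdots\times k}$ ($d$ modes, indexed by $[k]^d$) with nonnegative entries summing to one. For $i\in[b]$, let $h_{1,b,i}(x)=b\,\mathbf{1}\left(\frac{i-1}{b}\le x<\frac{i}{b}\right)$ on $[0,1)$, and let $\mathcal{H}_{1,b}$ be the convex hull of $\{h_{1,b,i}: i\in[b]\}$ (one-dimensional histograms with $b$ bins). For univariate functions, $\prod_{j=1}^d p_j$ denotes $(x_1,\ldots,x_d)\mapsto\prod_{j=1}^d p_j(x_j)$. The set of Tucker histograms is $$\widetilde{\mathcal{H}}_{d,b}^k=\left\{\sum_{S\in[k]^d}W_S\prod_{i=1}^d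 p_{i,S_i}\;:\;W\in\mathcal{T}_{d,k},\ p_{i,j}\in\mathcal{H}_{1,b}\right\}.$$ An estimator $V_n\in\widetilde{\mathcal{H}}_{d,b}^k$ is a function of the sample (not depending on $p$) with values in $\widetilde{\mathcal{H}}_{d,b}^k$. *)

(* Defs.v *)
From HB Require Import structures.
From mathcomp Require Import all_boot all_order all_algebra.
From mathcomp Require Import all_classical all_reals all_analysis.
From mathcomp Require Import measurable_realfun.

Unset Printing Implicit Defensive.

Import Order.TTheory GRing.Theory Num.Theory.
Import numFieldNormedType.Exports.

Local Open Scope classical_set_scope.
Local Open Scope ring_scope.

Section power_measure.
Context {dT : measure_display} {T : measurableType dT} {R : realType}.

Definition cons_pair {n} (z : T * n.-tuple T) : n.+1.-tuple T :=
  [tuple of z.1 :: z.2].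

Definition cons_measure {n} (mu : set T -> \bar R)
    (nu : set (n.-tuple T) -> \bar R) : set (n.+1.-tuple T) -> \bar R :=
  pushforward (product_measure1 mu nu) cons_pair.

(* The n-fold product of mu with itself, characterized by power_measure_box. *)
Fixpoint power_measure (mu : set T -> \bar R) (n : nat) :
    set (n.-tuple T) -> \bar R :=
  match n with
  | 0 => dirac ([tuple] : 0.-tuple T)
  | m.+1 => cons_measure mu (power_measure mu m)
  end.

Lemma measurable_cons_pair {n} : measurable_fun setT (@cons_pair n).
Proof. exact: measurable_cons. Qed.

Lemma cons_pair_box {n} (A : 'I_n.+1 -> set T) :
  cons_pair @^-1` [set x | forall i, A i (tnth x i)] =
  A ord0 `*` [set x | forall i, A (lift ord0 i) (tnth x i)].
Proof.
apply/seteqP; split=> [[x t] /= H|[x t] /= [H0 H] i].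
  split=> [|i]; first by have := H ord0; rewrite tnth0.
  by have := H (lift ord0 i); rewrite tnthS.
by case: (unliftP ord0 i) => [j|] ->; rewrite ?tnthS ?tnth0.
Qed.

Lemma measurable_tuple_box {n} (A : 'I_n -> set T) :
  (forall i, measurable (A i)) ->
  measurable [set x : n.-tuple T | forall i, A i (tnth x i)].
Proof.
move=> mA.
have -> : [set x : n.-tuple T | forall i, A i (tnth x i)] =
    \big[setI/setT]_(i < n) ((@tnth n T)^~ i @^-1` A i).
  apply/seteqP; split=> x /=.
    by move=> H; rewrite -bigcap_seq => i _; exact: H.
  by rewrite -bigcap_seq => H i; apply: H; rewrite /= mem_index_enum.
apply: bigsetI_measurable => i _.
by rewrite -[X in measurable X]setTI; exact: measurable_tnth.
Qed.

Section cons_measure_measure.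
Context (mu : {sigma_finite_measure set T -> \bar R}) (n : nat)
  (nu : {sigma_finite_measure set (n.-tuple T) -> \bar R}).
Local Notation m := (cons_measure mu nu).

Let mcons A : measurable A -> measurable (@cons_pair n @^-1` A).
Proof.
by move=> mA; rewrite -[X in measurable X]setTI; exact: measurable_cons_pair.
Qed.

Let m0 : m set0 = 0%E.
Proof. by rewrite /cons_measure /pushforward preimage_set0 measure0. Qed.

Let m_ge0 A : (0 <= m A)%E.
Proof. exact: (measure_ge0 (product_measure1 mu nu)). Qed.

Let m_sigma_additive : semi_sigma_additive m.
Proof.
move=> F mF tF mUF; rewrite /cons_measure /pushforward preimage_bigcup.
apply: measure_semi_sigma_additive.
- by move=> i; exact: mcons.
- apply/trivIsetP => /= i j _ _ ij; rewrite -preimage_setI.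
  by move/trivIsetP : tF => /(_ _ _ _ _ ij) ->//; rewrite preimage_set0.
- by rewrite -preimage_bigcup; exact: mcons.
Qed.

HB.instance Definition _ := isMeasure.Build _ _ _ m
  m0 m_ge0 m_sigma_additive.

Let m_sigma_finite : sigma_finite setT m.
Proof.
pose g (x : n.+1.-tuple T) : T * n.-tuple T := (thead x, [tuple of behead x]).
have gK : cancel g cons_pair.
  by move=> x; apply: val_inj; rewrite [in RHS](tuple_eta x).
have Kg : cancel (cons_pair) g.
  by move=> [x t]; congr pair; apply: val_inj.
have mg : measurable_fun setT g.
  apply/measurable_fun_pairP; split; last exact: measurable_behead.
  exact: (measurable_tnth ord0).
have /sigma_finiteP[F [FT ndF Foo]] := sigma_finiteT mu.
have /sigma_finiteP[G [GT ndG Goo]] := sigma_finiteT nu.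
exists (fun i => g @^-1` (F i `*` G i)) => [|i].
  rewrite -preimage_bigcup; apply/seteqP; split => // x _ /=.
  have [i _ Fi] : (\bigcup_i F i) (g x).1 by rewrite -FT.
  have [j _ Gj] : (\bigcup_i G i) (g x).2 by rewrite -GT.
  exists (maxn i j) => //; split.
    by move: Fi; exact/subsetPset/ndF/leq_maxl.
  by move: Gj; exact/subsetPset/ndG/leq_maxr.
have [mF Fi] := Foo i; have [mG Gi] := Goo i; split.
  by rewrite -[X in measurable X]setTI; apply: mg => //; exact: measurableX.
rewrite /cons_measure /pushforward (_ : _ @^-1` _ = F i `*` G i).
  by rewrite product_measure1E// lte_mul_pinfty// ge0_fin_numE.
by apply/funext => x; rewrite /preimage /mkset Kg.
Qed.

HB.instance Definition _ := Measure_isSigmaFinite.Build _ _ _ m m_sigma_finite.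

Lemma cons_measure_box (A : 'I_n.+1 -> set T) :
  (forall i, measurable (A i)) ->
  m [set x | forall i, A i (tnth x i)] =
  (mu (A ord0) * nu [set x | forall i, A (lift ord0 i) (tnth x i)])%E.
Proof.
move=> mA; rewrite /cons_measure /pushforward cons_pair_box.
rewrite product_measure1E//.
exact: (measurable_tuple_box (fun i => A (lift ord0 i))).
Qed.

End cons_measure_measure.

Section power_measure_measure.
Context (mu : {sigma_finite_measure set T -> \bar R}) (n : nat).

Lemma power_measureE m :
  exists nu : {sigma_finite_measure set (m.-tuple T) -> \bar R},
    power_measure mu m = nu.
Proof.
elim: m => [|m [nu IHm]]; first by exists (dirac ([tuple] : 0.-tuple T)).
by rewrite /= IHm; exists (cons_measure mu nu).
Qed.

Let m0 : power_measure mu n set0 = 0%E.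
Proof. by have [nu ->] := power_measureE n; exact: measure0. Qed.

Let m_ge0 A : (0 <= power_measure mu n A)%E.
Proof. by have [nu ->] := power_measureE n; exact: measure_ge0. Qed.

Let m_sigma_additive : semi_sigma_additive (power_measure mu n).
Proof.
by have [nu ->] := power_measureE n; exact: measure_semi_sigma_additive.
Qed.

HB.instance Definition _ := isMeasure.Build _ _ _ (power_measure mu n)
  m0 m_ge0 m_sigma_additive.

Let m_sigma_finite : sigma_finite setT (power_measure mu n).
Proof. by have [nu ->] := power_measureE n; exact: sigma_finiteT. Qed.

HB.instance Definition _ := Measure_isSigmaFinite.Build _ _ _
  (power_measure mu n) m_sigma_finite.

End power_measure_measure.

Lemma power_measure_box (mu : {sigma_finite_measure set T -> \bar R}) {n}
    (A : 'I_n -> set T) : (forall i, measurable (A i)) ->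
  power_measure mu n [set x | forall i, A i (tnth x i)] =
  (\prod_(i < n) mu (A i))%E.
Proof.
elim: n A => [|n IHn] A mA.
  rewrite big_ord0 /= diracE mem_set//= => i; by case: i.
rewrite /= cons_measure_box// big_ord_recl; congr (_ * _)%E.
exact: (IHn (fun i => A (lift ord0 i))).
Qed.

Lemma power_measure_setT (P : probability T R) n : power_measure P n setT = 1%E.
Proof.
have := power_measure_box P (fun _ : 'I_n => setT) (fun=> measurableT).
rewrite (_ : [set x | _] = setT); last by apply/seteqP; split.
by move=> ->; rewrite big1// => i _; exact: (probability_setT P).
Qed.

HB.instance Definition _ (P : probability T R) n :=
  Measure_isProbability.Build _ _ _ (power_measure P n) (power_measure_setT P n).

End power_measure.

Section histograms.
Context {R : realType}.
Local Notation Rb := (measurableTypeR R).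

Definition unit_cube d : set (d.-tuple Rb) :=
  [set x | forall i, tnth x i \in `[0, 1[%R].

Definition lebesgue_measure_d d : set (d.-tuple Rb) -> \bar R :=
  power_measure (@lebesgue_measure R) d.

Definition L1norm {d} (f : d.-tuple Rb -> R) : \bar R :=
  (\int[lebesgue_measure_d d]_(x in unit_cube d) `|f x|%:E)%E.

(* The infimum defining the L1 distance from p to H; for the sets H of Tucker
   histograms below it is a minimum, as they are compact in L1. *)
Definition L1dist {d} (p : d.-tuple Rb -> R) (H : set (d.-tuple Rb -> R)) :
    \bar R :=
  ereal_inf [set L1norm (p \- q) | q in H].

Definition densities d : set (d.-tuple Rb -> R) :=
  [set p : d.-tuple Rb -> R | [/\ measurable_fun (unit_cube d) p,
    (forall x, unit_cube d x -> 0 <= p x) &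
    (\int[lebesgue_measure_d d]_(x in unit_cube d) (p x)%:E = 1)%E]].

Definition density_law {d} (p : d.-tuple Rb -> R) :
    set (d.-tuple Rb) -> \bar R :=
  fun A => (\int[lebesgue_measure_d d]_(x in A `&` unit_cube d) (p x)%:E)%E.

(* Joint law of an iid sample X_1, ..., X_n of p, the X_i being the
   coordinates of the canonical sample space. *)
Definition sample_law {d} (p : d.-tuple Rb -> R) n :
    set (n.-tuple (d.-tuple Rb)) -> \bar R :=
  power_measure (density_law p) n.

Definition simplex (I : finType) : set (I -> R) :=
  [set w | (forall i, 0 <= w i) /\ \sum_i w i = 1].

(* Order-d tensors with d modes of size k are indexed by maps 'I_d -> 'I_k. *)
Definition prob_tensors d k : set ({ffun 'I_d -> 'I_k} -> R) :=
  simplex {ffun 'I_d -> 'I_k}.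

(* Bins are numbered from 0. *)
Definition bin_density {b} (i : 'I_b) (x : Rb) : R :=
  b%:R * \1_(`[i%:R / b%:R, i.+1%:R / b%:R[) x.

Definition histograms1 b : set (Rb -> R) :=
  [set (fun x => \sum_(i < b) w i * bin_density i x) | w in simplex 'I_b].

Definition tucker_histograms d b k : set (d.-tuple Rb -> R) :=
  [set f | exists (W : {ffun 'I_d -> 'I_k} -> R) (p : 'I_d -> 'I_k -> Rb -> R),
    [/\ prob_tensors d k W, (forall i j, histograms1 b (p i j)) &
      f = fun x => \sum_(S : {ffun 'I_d -> 'I_k})
        W S * \prod_(i < d) p i (S i) (tnth x i)]].

(* An H-valued function of the sample; so that it is a random element,
   measurability is required, jointly in the sample X and the point x
   at which the estimated density is evaluated. *)
Definition estimator {d n} (H : set (d.-tuple Rb -> R))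
    (V : n.-tuple (d.-tuple Rb) -> d.-tuple Rb -> R) : Prop :=
  (forall X, H (V X)) /\
  measurable_fun setT
    (fun z : n.-tuple (d.-tuple Rb) * d.-tuple Rb => V z.1 z.2).

Lemma measurable_unit_cube d : measurable (unit_cube d).
Proof.
apply: (measurable_tuple_box (T := Rb) (n := d) (fun=> `[0, 1[%classic)) => i.
exact: measurable_itv.
Qed.

Section density_law_measure.
Context d (p : d.-tuple Rb -> R) (Dp : densities d p).
Local Notation P := (density_law p).

Let P0 : P set0 = 0%E.
Proof. by rewrite /density_law set0I integral_set0. Qed.

Let P_ge0 A : (0 <= P A)%E.
Proof.
have [_ p0 _] := Dp.
by apply: integral_ge0 => x [_ Ux]; rewrite lee_fin p0.
Qed.

Let P_sigma_additive : semi_sigma_additive P.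
Proof.
have [mp p0 _] := Dp; have mU := measurable_unit_cube d.
move=> F mF tF mUF; rewrite /density_law; apply: cvg_toP.
  apply: ereal_nondecreasing_is_cvgn => m n mn.
  apply: lee_sum_nneg_natr => // k _ _; exact: P_ge0.
rewrite setI_bigcupl ge0_integral_bigcup//=.
- by move=> k; exact: measurableI.
- apply/measurable_EFinP; apply: measurable_funS mp => //.
  by move=> x [k _ []].
- by move=> x [k _ [_ Ux]]; rewrite lee_fin p0.
- exact: trivIset_setIr.
Qed.

Let P_setT : P setT = 1%E.
Proof. by have [_ _ p1] := Dp; rewrite /density_law setTI. Qed.

Lemma density_lawE : exists Q : probability (d.-tuple Rb) R, P = Q.
Proof.
pose M := isMeasure.Build _ _ _ P P0 P_ge0 P_sigma_additive.
pose Pm : {measure set (d.-tuple Rb) -> \bar R} := HB.pack P M.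
pose N := Measure_isProbability.Build _ _ R Pm P_setT.
pose Q : probability (d.-tuple Rb) R := HB.pack (Measure.sort Pm) N.
by exists Q.
Qed.

End density_law_measure.

End histograms.

(* Main.v *)
Require Import Defs.
From HB Require Import structures.
From mathcomp Require Import all_boot all_order all_algebra.
From mathcomp Require Import all_classical all_reals all_analysis.
From mathcomp Require Import measurable_realfun ring lra.

(** The estimator is the minimum distance (Yatracos) estimator over a finite
    L1-net of the Tucker histograms.

    Let [q i], [i] in [I], be finitely many densities, let
    [A (j, l) = {q l < q j}] be the sets on which one of them exceeds another,
    and let [V] be the [q i] whose probabilities of the sets [A (j, l)] are
    uniformly closest to the empirical frequencies. Two candidates are at L1
    distance twice the difference of their probabilities of one of these sets,
    and for an arbitrary density [p] the difference [q i - p] has integral at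
    most half its L1 norm over any set. The triangle inequality then gives
    [|V - p| <= 3 |q i - p| + 4 delta] for every [i], where [delta] is the
    largest deviation of an empirical frequency from the true probability
    ([min_distance_le]). There are [#|I| ^ 2] sets, so Hoeffding's inequality
    and a union bound ([empirical_deviation]) give [delta <= e] outside an event
    of probability [2 #|I| ^ 2 exp (- n e ^ 2 / 8)], uniformly in [p].

    A Tucker histogram is given by the [k ^ d] weights of its tensor and the
    [d k b] weights of its factors. Cutting the values of these weights into
    intervals of length [1 / m2] and [1 / m1], and choosing one histogram in
    every nonempty cell, gives a net of radius [k ^ d / m2 + d b / m1]
    ([ex_tucker_net]): the radius is additive because a product of densities
    is 1-Lipschitz in L1 in each factor ([L1norm_tuckerB_le]). With
    [m1 = b ^ 2] and [m2 = (k ^ d) ^ 2] the radius [1 / k ^ d + d / b] tends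
    to [0], while the logarithm of the size of the net is still at most a
    constant times [b k log b + k ^ d log (k ^ d)], which is [o(n)] by
    hypothesis; hence the bound on the probability tends to [0]
    ([net_size_tail]). As the net does not depend on the error [eps], neither
    does the estimator. *)

Set Implicit Arguments.
Unset Strict Implicit.
Unset Printing Implicit Defensive.

Import Order.TTheory GRing.Theory Num.Theory.
Import numFieldNormedType.Exports.

Local Open Scope classical_set_scope.
Local Open Scope ring_scope.

(** * Concentration of empirical frequencies *)

Lemma measurable_prod_tnth dT (T : measurableType dT) (R : realType) n
    (g : 'I_n -> T -> R) : (forall i, measurable_fun setT (g i)) ->
  measurable_fun setT (fun x : n.-tuple T => \prod_(i < n) g i (tnth x i)).
Proof.
move=> mg; apply: measurable_prod => i _.
by apply: measurableT_comp => //; exact: measurable_tnth.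
Qed.

(** Fubini for products of functions of one coordinate. It is used twice: with
    the law of one observation, for the exponential moments of a sample, and
    with the Lebesgue measure, for the integrals of products of histograms. *)
Lemma integral_power_measure_prod dT (T : measurableType dT) (R : realType)
    (mu : {sigma_finite_measure set T -> \bar R}) n
    (g : 'I_n -> T -> R) (c : 'I_n -> R) :
  (forall i, measurable_fun setT (g i)) -> (forall i x, 0 <= g i x) ->
  (forall i, \int[mu]_x (g i x)%:E = (c i)%:E)%E ->
  (\int[power_measure mu n]_x (\prod_(i < n) g i (tnth x i))%:E =
   (\prod_(i < n) c i)%:E)%E.
Proof.
elim: n g c => [|n IHn] g c mg g0 gc.
  rewrite /= integral_dirac//; last first.
    by apply/measurable_EFinP; exact: measurable_prod_tnth.
  by rewrite [X in (X * _)%E](_ : _ = 1%E) ?mul1e ?big_ord0// /dirac /= indicT.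
have mF : measurable_fun setT
    (fun x : n.+1.-tuple T => (\prod_(i < n.+1) g i (tnth x i))%:E).
  apply/measurable_EFinP; exact: measurable_prod_tnth.
have F0 (x : n.+1.-tuple T) :
    (0 <= (\prod_(i < n.+1) g i (tnth x i))%:E :> \bar R)%E.
  by rewrite lee_fin; apply: prodr_ge0.
rewrite /= /cons_measure.
rewrite ge0_integral_pushforward//=; last exact: measurable_cons_pair.
rewrite preimage_setT.
pose h (t : n.-tuple T) := \prod_(i < n) g (lift ord0 i) (tnth t i).
have mh : measurable_fun setT h.
  exact: (measurable_prod_tnth (g := fun i => g (lift ord0 i))).
have h0 t : 0 <= h t by apply: prodr_ge0.
have intg i : 0 <= c i.
  by rewrite -lee_fin -gc integral_ge0// => x _; rewrite lee_fin.
rewrite (eq_integral (fun z : T * n.-tuple T => (g ord0 z.1 * h z.2)%:E));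
  last first.
  move=> [x t] _ /=; rewrite big_ord_recl tnth0.
  by under eq_bigr do rewrite tnthS.
rewrite fubini_tonelli1//=; last 2 first.
- apply/measurable_EFinP; apply: measurable_funM.
    by apply: measurableT_comp.
  by apply: measurableT_comp.
- by move=> x; rewrite lee_fin mulr_ge0.
rewrite (eq_integral (fun x =>
    (\prod_(i < n) c (lift ord0 i))%:E * (g ord0 x)%:E)%E); last first.
  move=> x _; rewrite /fubini_F /=.
  under eq_integral do rewrite EFinM.
  rewrite ge0_integralZl//.
  - rewrite (IHn (fun i => g (lift ord0 i)) (fun i => c (lift ord0 i)))//.
    by rewrite muleC.
  - by apply/measurable_EFinP.
  - by move=> y _; rewrite lee_fin.
  - by rewrite lee_fin.
rewrite ge0_integralZl_EFin//.
- by rewrite gc big_ord_recl -EFinM mulrC.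
- by move=> x _; rewrite lee_fin.
- by apply/measurable_EFinP.
- exact: prodr_ge0.
Qed.

(** From [exp (- x) >= 1 - x]: then [exp x <= 1 / (1 - x)], which is at most
    the right-hand side for [x <= 1 / 2]. *)
Lemma expR_le_quadratic (R : realType) (x : R) :
  x <= 2^-1 -> expR x <= 1 + x + 2 * x ^+ 2.
Proof.
move=> x2.
have q0 : 0 < 1 - x by lra.
have le1 : expR x * (1 - x) <= 1.
  rewrite -[leRHS](expR0 R) -(subrr x) expRD ler_wpM2l ?expR_ge0//.
  exact: expR_ge1Dx.
have x20 := sqr_ge0 x.
rewrite -(ler_pM2r q0) (le_trans le1)// -subr_ge0.
rewrite (_ : _ - 1 = x ^+ 2 * (1 - 2 * x)); last by ring.
by rewrite mulr_ge0//; lra.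
Qed.

Lemma measurable_set_ltr dT (T : measurableType dT) (R : realType)
    (f g : T -> R) : measurable_fun setT f -> measurable_fun setT g ->
  measurable [set x | f x < g x].
Proof.
move=> mf mg; rewrite -[X in measurable X]setCK; apply: measurableC.
rewrite (_ : ~` _ = setT `&` [set x | g x <= f x]).
  exact: measurable_fun_le.
by rewrite setTI; apply/seteqP; split => x /=; rewrite leNgt => /negP.
Qed.

Lemma measurable_sample_count dT (T : measurableType dT) (R : realType)
    (A : set T) n : measurable A ->
  measurable_fun setT (fun X : n.-tuple T => \sum_(t < n) \1_A (tnth X t) : R).
Proof.
move=> mA; apply: measurable_sum => t.
apply: (@measurableT_comp _ _ _ _ _ _ (\1_A : T -> R)).
  exact: measurable_indic.
exact: measurable_tnth.
Qed.

Section chernoff.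
Context dT (T : measurableType dT) (R : realType) (Q : probability T R).
Variables (A : set T) (mA : measurable A).
Local Notation a := (fine (Q A)).

Let Qa : Q A = a%:E.
Proof. by rewrite fineK// fin_num_measure. Qed.

Let a_ge0 : 0 <= a. Proof. exact: fine_ge0. Qed.

Lemma integral_expR_indic (l r : R) :
  (\int[Q]_x (expR (l * (\1_A x - a) - r))%:E =
   (expR (- (l * a) - r) * (1 + a * (expR l - 1)))%:E)%E.
Proof.
set u := expR (l * (1 - a) - r); set v := expR (l * (0 - a) - r).
rewrite (eq_integral (fun x => u%:E * (\1_A x)%:E + v%:E * (\1_(~` A) x)%:E)%E);
  last first.
  move=> x _; rewrite !indicE in_setC.
  case: (x \in A) => /=; first by rewrite mule1 mule0 adde0.
  by rewrite mule1 mule0 add0e.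
have mAc : measurable (~` A) by exact: measurableC.
rewrite ge0_integralD//; first last.
- by apply: measurable_funeM; apply/measurable_EFinP; exact: measurable_indic.
- by move=> x _; rewrite mule_ge0// lee_fin ?expR_ge0.
- by apply: measurable_funeM; apply/measurable_EFinP; exact: measurable_indic.
- by move=> x _; rewrite mule_ge0// lee_fin ?expR_ge0.
rewrite !ge0_integralZl_EFin ?expR_ge0//; try (by move=> x _; rewrite lee_fin);
  try (by apply/measurable_EFinP; exact: measurable_indic).
rewrite !integral_indic// !setIT.
have QC : Q (~` A) = (1 - a)%:E.
  by apply: (etrans (probability_setC Q mA)); rewrite Qa EFinB.
transitivity (u%:E * a%:E + v%:E * (1 - a)%:E)%E.
  by congr (_ * _ + _ * _)%E; [exact: Qa|exact: QC].
rewrite -!EFinM -EFinD; congr EFin.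
rewrite /u /v (_ : l * (1 - a) - r = (- (l * a) - r) + l); last by ring.
rewrite (_ : l * (0 - a) - r = - (l * a) - r); last by ring.
rewrite [expR (_ + l)]expRD; ring.
Qed.

(** Markov's inequality for the exponential of the sum. With
    [exp l - 1 <= l + 2 l ^ 2] and [1 + y <= exp y], the centered indicator has
    exponential moment at most [exp (2 a l ^ 2) <= exp (2 l ^ 2)]; the sign of
    [l] selects the upper or the lower tail. *)
Lemma chernoff_indic (l r : R) n : `|l| <= 2^-1 ->
  (power_measure Q n
     [set X | (n%:R * r <= l * (\sum_(t < n) \1_A (tnth X t) - n%:R * a))%R] <=
   (expR (n%:R * (2 * l ^+ 2 - r)))%:E)%E.
Proof.
move=> l2; set B := [set X | _].
have mB : measurable B.
  rewrite -[B]setTI; apply: measurable_fun_le => //.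
  apply: measurable_funM => //; apply: measurable_funB => //.
  exact: measurable_sample_count.
rewrite -[X in power_measure _ _ X]setIT -integral_indic//.
have mg : measurable_fun setT (fun x : T => expR (l * (\1_A x - a) - r) : R).
  apply: measurableT_comp => //; apply: measurable_funB => //.
  by apply: measurable_funM => //; apply: measurable_funB.
apply: (@le_trans _ _ (\int[power_measure Q n]_X
    (\prod_(t < n) expR (l * (\1_A (tnth X t) - a) - r))%:E)%E).
  apply: ge0_le_integral => //.
  - by apply/measurable_EFinP; exact: measurable_indic.
  - apply/measurable_EFinP.
    exact: (measurable_prod_tnth (g := fun _ x => expR (l * (\1_A x - a) - r))).
  - move=> X _; rewrite lee_fin indicE.
    case: (boolP (X \in B)) => /= [|_]; last first.
      by apply: prodr_ge0 => i _; exact: expR_ge0.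
    rewrite inE /B /= => HX; rewrite -expR_sum.
    rewrite -[leLHS](expR0 R) ler_expR sumrB -mulr_sumr sumrB.
    rewrite !sumr_const card_ord -[a *+ n]mulr_natl -[r *+ n]mulr_natl.
    by rewrite subr_ge0.
rewrite (integral_power_measure_prod
  (g := fun _ x => expR (l * (\1_A x - a) - r))
  (fun=> mg) _ (fun=> integral_expR_indic l r)); last first.
  by move=> *; exact: expR_ge0.
rewrite prodr_const card_ord lee_fin expRM_natl.
rewrite lerXn2r ?nnegrE ?expR_ge0//.
  by rewrite -lee_fin -integral_expR_indic integral_ge0// => x _;
    rewrite lee_fin expR_ge0.
have el := expR_le_quadratic (le_trans (ler_norm l) l2).
have a1 : a <= 1 by rewrite -lee_fin -Qa probability_le1.
have l20 := sqr_ge0 l.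
apply: (@le_trans _ _ (expR (- (l * a) - r) * expR (a * (l + 2 * l ^+ 2)))).
  rewrite ler_wpM2l ?expR_ge0//; apply: le_trans (expR_ge1Dx _).
  rewrite lerD2l ler_wpM2l//; lra.
rewrite -expRD ler_expR.
have : a * l ^+ 2 <= l ^+ 2 by rewrite ler_piMl.
lra.
Qed.

(** The choice [l = e / 4] and [l = - e / 4] in [chernoff_indic]; the constant
    [1 / 8] is not optimal, but any rate exponential in [n] suffices below. *)
Lemma hoeffding_indic (e : R) n : 0 < e <= 2 ->
  (power_measure Q n
     [set X | (n%:R * e < `| \sum_(t < n) \1_A (tnth X t) - n%:R * a |)%R] <=
   (2 * expR (- (n%:R * (e ^+ 2 / 8))))%:E)%E.
Proof.
move=> /andP[e0 e2].
pose B (l : R) : set (n.-tuple T) := [set X |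
  n%:R * (e ^+ 2 / 4) <= l * (\sum_(t < n) \1_A (tnth X t) - n%:R * a)].
have mB l : measurable (B l).
  rewrite -[B l]setTI; apply: measurable_fun_le => //.
  apply: measurable_funM => //; apply: measurable_funB => //.
  exact: measurable_sample_count.
have PB l : `|l| = e / 4 ->
    (power_measure Q n (B l) <= (expR (- (n%:R * (e ^+ 2 / 8))))%:E)%E.
  move=> le; apply: le_trans (chernoff_indic _ _ _) _; first by rewrite le; lra.
  rewrite lee_fin ler_expR -[l ^+ 2]ger0_norm ?sqr_ge0// normrX le.
  rewrite (_ : 2 * (e / 4) ^+ 2 - e ^+ 2 / 4 = - (e ^+ 2 / 8)) ?mulrN//.
  by field.
have mC : measurable [set X : n.-tuple T |
    n%:R * e < `| \sum_(t < n) \1_A (tnth X t) - n%:R * a |].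
  apply: measurable_set_ltr => //; apply: measurableT_comp => //.
  by apply: measurable_funB => //; exact: measurable_sample_count.
have e40 : 0 < e / 4 by lra.
apply: (@le_trans _ _ (power_measure Q n (B (e / 4) `|` B (- (e / 4))))).
  apply: le_measure; rewrite ?inE//; first exact: measurableU.
  move=> X; rewrite /B /= ltr_normr => /orP[/ltW h|/ltW h]; [left|right];
    rewrite (_ : n%:R * (e ^+ 2 / 4) = (e / 4) * (n%:R * e)); try (by ring).
  - by have := ler_wpM2l (ltW e40) h; lra.
  - by have := ler_wpM2l (ltW e40) h; lra.
apply: le_trans (measureU2 _ _ _) _ => //.
rewrite mulr_natl mulr2n EFinD.
by apply: leeD; apply: PB; rewrite ?normrN gtr0_norm//; lra.
Qed.

End chernoff.

(** * Minimum distance selection among finitely many densities *)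

Section minimum_distance.
Context dT (T : measurableType dT) (R : realType).
Variables (mu : {measure set T -> \bar R}) (D : set T) (mD : measurable D).
Implicit Types f g p : T -> R.

Let integrable_sub A f : measurable A -> A `<=` D ->
  mu.-integrable D (EFin \o f) -> mu.-integrable A (EFin \o f).
Proof. by move=> mA AD; exact: integrableS. Qed.

Let integrable_abs A f : mu.-integrable A (EFin \o f) ->
  mu.-integrable A (EFin \o (fun x => `|f x|)).
Proof. exact: integrable_norm. Qed.

Lemma Rintegral_split A f : measurable A -> A `<=` D ->
    mu.-integrable D (EFin \o f) ->
  \int[mu]_(x in D) f x = \int[mu]_(x in A) f x + \int[mu]_(x in D `\` A) f x.
Proof.
move=> mA AD fi; have mDA : measurable (D `\` A) by exact: measurableD.
have DE : D = A `|` (D `\` A) by rewrite setDUK.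
rewrite {1}DE Rintegral_setU//; first by rewrite -DE.
by rewrite disj_set2E; apply/eqP; apply/seteqP; split => // x [? []].
Qed.

(** The integrals of [f] over [A] and over its complement are opposite, so each
    of them takes at most half of the L1 norm. *)
Lemma centered_Rintegral_le A f : measurable A -> A `<=` D ->
    mu.-integrable D (EFin \o f) -> \int[mu]_(x in D) f x = 0 ->
  2 * `| \int[mu]_(x in A) f x | <= \int[mu]_(x in D) `|f x|.
Proof.
move=> mA AD fi f0; have mDA : measurable (D `\` A) by exact: measurableD.
have DAD : D `\` A `<=` D by apply: subDsetl.
have := Rintegral_split mA AD fi; rewrite f0 => /esym/eqP.
rewrite addr_eq0 => /eqP fE.
rewrite (Rintegral_split mA AD (integrable_abs fi)).
have h1 := le_normr_Rintegral mA (integrable_sub mA AD fi).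
have h2 := le_normr_Rintegral mDA (integrable_sub mDA DAD fi).
move: h1 h2; rewrite fE normrN; lra.
Qed.

(** Scheffe's identity: [{f > 0}] is a set for which [centered_Rintegral_le]
    is an equality. *)
Lemma Rintegral_norm_centered f : measurable_fun setT f ->
    mu.-integrable D (EFin \o f) -> \int[mu]_(x in D) f x = 0 ->
  \int[mu]_(x in D) `|f x| = 2 * \int[mu]_(x in D `&` [set x | 0 < f x]) f x.
Proof.
move=> mf fi f0; set A := D `&` _.
have mA : measurable A by apply: measurableI => //; exact: measurable_set_ltr.
have AD : A `<=` D by apply: subIsetl.
have mDA : measurable (D `\` A) by exact: measurableD.
have DAD : D `\` A `<=` D by apply: subDsetl.
rewrite (Rintegral_split mA AD (integrable_abs fi)).
have := Rintegral_split mA AD fi; rewrite f0 => /esym/eqP.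
rewrite addr_eq0 => /eqP fE.
rewrite (_ : Rintegral _ A (fun x => `|f x|) = Rintegral mu A f); last first.
  by apply: eq_Rintegral => x; rewrite inE => -[_ /= /ltW]; exact: ger0_norm.
rewrite (_ : Rintegral _ (D `\` A) (fun x => `|f x|) =
    Rintegral mu (D `\` A) (fun x => -1 * f x)); last first.
  apply: eq_Rintegral => x; rewrite inE => -[Dx nAx].
  rewrite mulN1r ler0_norm//.
  by rewrite leNgt; apply/negP => fx; apply: nAx.
rewrite RintegralZl//; last exact: integrable_sub.
by rewrite fE; ring.
Qed.

Lemma Rintegral_dist_triangle f g h : mu.-integrable D (EFin \o f) ->
    mu.-integrable D (EFin \o g) -> mu.-integrable D (EFin \o h) ->
  \int[mu]_(x in D) `|f x - h x| <=
  \int[mu]_(x in D) `|f x - g x| + \int[mu]_(x in D) `|g x - h x|.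
Proof.
move=> fi gi hi.
have subi u v : mu.-integrable D (EFin \o u) -> mu.-integrable D (EFin \o v) ->
    mu.-integrable D (EFin \o (fun x => `|u x - v x|)).
  by move=> ui vi; apply: integrable_norm; exact: (integrableB mD ui vi).
rewrite -RintegralD//; [|exact: subi|exact: subi].
apply: le_Rintegral => //; first exact: subi.
  by apply: (integrableD mD (subi _ _ fi gi) (subi _ _ gi hi)).
by move=> x _; exact: ler_distD.
Qed.

Context (I : finType) (q : I -> T -> R).

Definition yatracos (jl : I * I) : set T := D `&` [set x | q jl.2 x < q jl.1 x].

Definition discrepancy (nu : I * I -> R) (i : I) : R :=
  \big[Num.max/0]_jl `| \int[mu]_(x in yatracos jl) q i x - nu jl |.

Definition min_distance (i0 : I) (nu : I * I -> R) : I :=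
  [arg min_(i < i0) discrepancy nu i]%O.

Hypothesis mq : forall i, measurable_fun setT (q i).
Hypothesis qi : forall i, mu.-integrable D (EFin \o q i).
Hypothesis q1 : forall i, \int[mu]_(x in D) q i x = 1.

Lemma measurable_yatracos jl : measurable (yatracos jl).
Proof. by apply: measurableI => //; exact: measurable_set_ltr. Qed.

Let yatD jl : yatracos jl `<=` D. Proof. exact: subIsetl. Qed.

(** Write [m] for the selected index. Scheffe's identity on the set where
    [q m > q i] and the minimality of [m] bound the distance from [q m] to [q i]
    by four times the discrepancy of [i]; the latter is at most half the
    distance from [q i] to [p], plus [delta]. *)
Lemma min_distance_le i0 p nu (delta : R) (i : I) :
  mu.-integrable D (EFin \o p) -> \int[mu]_(x in D) p x = 1 ->
  (forall jl, `| \int[mu]_(x in yatracos jl) p x - nu jl | <= delta) ->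
  \int[mu]_(x in D) `| q (min_distance i0 nu) x - p x | <=
  3 * \int[mu]_(x in D) `| q i x - p x | + 4 * delta.
Proof.
move=> pi p1 pnu; rewrite /min_distance.
case: arg_minP => //= m _ mmin.
have disc_ge j jl :
    `| \int[mu]_(x in yatracos jl) q j x - nu jl | <= discrepancy nu j.
  by rewrite /discrepancy (le_bigmax_cond _
    (fun jl => `| \int[mu]_(x in yatracos jl) q j x - nu jl |)).
have delta0 : 0 <= delta by apply: le_trans (pnu (i0, i0)).
have bi j f : mu.-integrable D (EFin \o f) ->
    mu.-integrable D (EFin \o (fun x => q j x - f x)).
  by move=> fi; apply: (integrableB mD (qi j) fi).
have cent j f : mu.-integrable D (EFin \o f) -> \int[mu]_(x in D) f x = 1 ->
    \int[mu]_(x in D) (q j x - f x) = 0.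
  by move=> fi f1; rewrite RintegralB// q1 f1 subrr.
have sub jl j f : mu.-integrable D (EFin \o f) ->
    \int[mu]_(x in yatracos jl) (q j x - f x) =
    \int[mu]_(x in yatracos jl) q j x - \int[mu]_(x in yatracos jl) f x.
  move=> fi; have mY := measurable_yatracos jl.
  by rewrite RintegralB//; exact: integrable_sub.
have disc_le : 2 * discrepancy nu i <=
    \int[mu]_(x in D) `| q i x - p x | + 2 * delta.
  suff : discrepancy nu i <=
    2^-1 * \int[mu]_(x in D) `| q i x - p x | + delta by lra.
  apply: bigmax_le => [|jl _].
    by rewrite addr_ge0// mulr_ge0// Rintegral_ge0.
  have := centered_Rintegral_le (measurable_yatracos jl) (@yatD jl)
    (bi i p pi) (cent i p pi p1).
  rewrite sub//; have := pnu jl.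
  have := ler_distD (\int[mu]_(x in yatracos jl) p x)
    (\int[mu]_(x in yatracos jl) q i x) (nu jl).
  lra.
have qq : \int[mu]_(x in D) `| q m x - q i x | <= 4 * discrepancy nu i.
  rewrite Rintegral_norm_centered//;
    [|exact: measurable_funB|exact: bi|exact: cent].
  rewrite (_ : D `&` _ = yatracos (m, i)); last first.
    by apply/seteqP; split=> x /= [Dx]; rewrite subr_gt0.
  rewrite sub//; have := disc_ge m (m, i).
  have := disc_ge i (m, i); have := mmin i isT.
  rewrite !ler_norml; move=> h /andP[h1 h2] /andP[h3 h4]; lra.
have := Rintegral_dist_triangle (qi m) (qi i) pi; lra.
Qed.

End minimum_distance.

(** * Events of the empirical frequencies *)

Lemma measurable_finite_preimage dT (T : measurableType dT) (F : finType)
    (e : T -> F) (S : set F) :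
  (forall c, measurable (e @^-1` [set c])) -> measurable (e @^-1` S).
Proof.
move=> me; rewrite (_ : e @^-1` S = \bigcup_(c in S) (e @^-1` [set c])).
  by apply: fin_bigcup_measurable => //; exact: finite_finset.
by apply/seteqP; split => [x Sx|x [c Sc /= ->]//]; exists (e x).
Qed.

Section empirical_measure.
Context dT (T : measurableType dT) (R : realType) (J : finType).
Variables (A : J -> set T) (mA : forall j, measurable (A j)).

Definition empirical n (X : n.-tuple T) (j : J) : R :=
  n%:R^-1 * \sum_(t < n) \1_(A j) (tnth X t).

(** The empirical frequencies depend on the sample only through the finite
    table of the memberships of its points in the sets [A j]. So every event
    expressed with them is a finite union of measurable fibers, whatever [S]
    is; this disposes of all measurability questions about the choice of the
    minimizer. *)
Lemma measurable_empirical n (S : set (J -> R)) :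
  measurable [set X : n.-tuple T | S (empirical X)].
Proof.
pose e (X : n.-tuple T) : {ffun 'I_n * J -> bool} :=
  [ffun tj => tnth X tj.1 \in A tj.2].
pose emp (c : {ffun 'I_n * J -> bool}) j : R :=
  n%:R^-1 * \sum_(t < n) (c (t, j))%:R.
rewrite (_ : [set X | _] = e @^-1` [set c | S (emp c)]); last first.
  have eE X : emp (e X) = empirical X.
    apply/funext => j; rewrite /emp /empirical; congr (_ * _).
    by apply: eq_bigr => t _; rewrite ffunE /= indicE.
  by apply/seteqP; split => X /=; rewrite eE.
apply: measurable_finite_preimage => c.
rewrite (_ : _ @^-1` _ = \bigcap_(tj in [set: 'I_n * J])
   ((fun X : n.-tuple T => tnth X tj.1) @^-1`
    (if c tj then A tj.2 else ~` A tj.2))).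
  apply: fin_bigcap_measurable => [|tj _]; first exact: finite_finset.
  rewrite -[X in measurable X]setTI; apply: measurable_tnth => //.
  by case: (c tj) => //; exact: measurableC.
apply/seteqP; split => X /=.
  by move=> <- tj _ /=; rewrite ffunE; case: ifPn; rewrite ?inE ?notin_setE.
move=> H; apply/ffunP => tj; rewrite ffunE; have := H tj I => /=.
by case: (c tj); [rewrite -inE|move=> h; apply/negbTE; rewrite notin_setE].
Qed.

Lemma measurable_selected n (I : finType) (sel : (J -> R) -> I)
    (q : I -> T -> R) :
  (forall i, measurable_fun setT (q i)) ->
  measurable_fun setT
    (fun z : n.-tuple T * T => q (sel (empirical z.1)) z.2).
Proof.
move=> mq _ Y mY; rewrite setTI.
rewrite (_ : _ @^-1` _ = \bigcup_(i in [set: I])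
   ([set X : n.-tuple T | sel (empirical X) = i] `*` (q i @^-1` Y))); last first.
  apply/seteqP; split => [[X x] /= Yx|[X x] [i _ [/= <-]]//].
  by exists (sel (empirical X)).
apply: fin_bigcup_measurable => [|i _]; first exact: finite_finset.
apply: measurableX; first exact: (measurable_empirical (fun nu => sel nu = i)).
by rewrite -[X in measurable X]setTI; exact: mq.
Qed.

Lemma empirical_deviation (Q : probability T R) n (e : R) :
  (0 < n)%N -> 0 < e <= 2 ->
  (power_measure Q n
     [set X | ~ forall j, `| fine (Q (A j)) - empirical X j | <= e]%R <=
   (#|J|%:R * (2 * expR (- (n%:R * (e ^+ 2 / 8)))))%:E)%E.
Proof.
move=> n0 e02.
have mB (j : J) := measurable_empirical (n := n)
  [set nu | ~ (`| fine (Q (A j)) - nu j | <= e)].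
have PB j : (power_measure Q n
      [set X | ~ (`| fine (Q (A j)) - empirical X j | <= e)%R]
    <= (2 * expR (- (n%:R * (e ^+ 2 / 8))))%:E)%E.
  rewrite (_ : [set X | _] =
     [set X | (n%:R * e <
       `| \sum_(t < n) \1_(A j) (tnth X t) - n%:R * fine (Q (A j)) |)%R]).
    exact: hoeffding_indic.
  have nR : (0 : R) < n%:R by rewrite ltr0n.
  apply/seteqP; split => X /=; rewrite /empirical.
  - move/negP; rewrite -ltNge distrC -(ltr_pM2l nR) => /lt_le_trans; apply.
    rewrite -[X in X * `|_|](gtr0_norm nR) -normrM mulrBr mulrA mulfV ?mul1r//.
    by rewrite gt_eqF.
  - move=> h; apply/negP; rewrite -ltNge distrC -(ltr_pM2l nR).
    rewrite (lt_le_trans h)//.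
    rewrite -[X in X * `|_|](gtr0_norm nR) -normrM mulrBr mulrA mulfV ?mul1r//.
    by rewrite gt_eqF.
rewrite (_ : [set X | _] = \big[setU/set0]_(j <- index_enum J)
   [set X | ~ (`| fine (Q (A j)) - empirical X j | <= e)%R]); last first.
  rewrite -bigcup_seq; apply/seteqP; split => X /=.
    move/existsNP => [j hj]; exists j => //=; exact: mem_index_enum.
  by move=> [j _ hj] /(_ j).
rewrite -sum1_card (_ : \sum_(j in J) 1 = size (index_enum J))%N; last first.
  by rewrite sum1_size.
elim: (index_enum J) => [|j s IH]; first by rewrite !big_nil measure0 mul0r.
rewrite !big_cons /=; apply: le_trans (measureU2 _ _ _) _; first exact: mB.
  by apply: bigsetU_measurable => k _; exact: mB.
rewrite -natr1 mulrDl mul1r [X in X%:E]addrC EFinD.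
by apply: leeD; [exact: PB|exact: IH].
Qed.

End empirical_measure.

(** * Integrals of products of histograms *)

(** The factors [a' j] are replaced by [a j] one at a time. The bound is a sum
    of products of one term for each index, so that its integral factorizes
    when each term depends on its own coordinate. *)
Lemma ler_prod_telescope (R : realDomainType) d (a a' e : 'I_d -> R) :
  (forall i, 0 <= a i) -> (forall i, 0 <= a' i) ->
  (forall i, `|a i - a' i| <= e i) ->
  `| \prod_i a i - \prod_i a' i | <=
  \sum_(i < d) \prod_(j < d)
    (if (j < i)%N then a j else if j == i then e j else a' j).
Proof.
elim: d a a' e => [|d IHd] a a' e a0 a0' ae.
  by rewrite !big_ord0 subrr normr0.
pose w (i : 'I_d) := widen_ord (leqnSn d) i.
rewrite !big_ord_recr /=; set A := \prod_i _; set A' := \prod_i _.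
rewrite (_ : A * a ord_max - A' * a' ord_max =
  (A - A') * a' ord_max + A * (a ord_max - a' ord_max)); last by ring.
rewrite (le_trans (ler_normD _ _))// !normrM lerD//; last first.
  rewrite ger0_norm; last by apply: prodr_ge0.
  rewrite ltnn eqxx ler_pM ?prodr_ge0//.
  rewrite le_eqVlt; apply/orP; left; apply/eqP; apply: eq_bigr => i _.
  by rewrite /= ltn_ord.
rewrite [X in _ * X]ger0_norm//.
apply: (@le_trans _ _ ((\sum_(i < d) \prod_(j < d) (if (j < i)%N then a (w j)
    else if j == i then e (w j) else a' (w j))) * a' ord_max)).
  rewrite ler_wpM2r//.
  by apply: (IHd (fun i => a (w i)) (fun i => a' (w i)) (fun i => e (w i))).
rewrite mulr_suml ler_sum// => i _; rewrite big_ord_recr /=.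
rewrite ltnNge ltnW//= -val_eqE /= gtn_eqF//.
Qed.

Section histogram_integrals.
Context {R : realType}.
Local Notation Rb := (measurableTypeR R).
Local Notation leb := (@lebesgue_measure R).

Definition hist b (w : 'I_b -> R) (x : Rb) : R :=
  \sum_(i < b) w i * bin_density i x.

Lemma bin_density_ge0 b (i : 'I_b) (x : Rb) : 0 <= bin_density i x.
Proof. by rewrite /bin_density mulr_ge0. Qed.

Lemma measurable_bin_density b (i : 'I_b) :
  measurable_fun setT (@bin_density R b i).
Proof.
apply: measurable_funM => //; apply: measurable_indic; exact: measurable_itv.
Qed.

Lemma integral_bin_density b (i : 'I_b) :
  (\int[leb]_x (bin_density i x)%:E = 1)%E.
Proof.
have b0 : (0 : R) < b%:R by rewrite ltr0n; case: b i => // -[].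
rewrite /bin_density; under eq_integral do rewrite EFinM.
rewrite ge0_integralZl_EFin//; last first.
  by apply/measurable_EFinP; exact: (measurable_indic (measurable_itv _)).
rewrite integral_indic//.
have := lebesgue_measure_itv `[(i%:R / b%:R : R), (i.+1%:R / b%:R)[.
rewrite /= lte_fin ltr_pM2r ?invr_gt0// ltr_nat ltnSn -EFinB => lE.
rewrite setIT.
transitivity (b%:R%:E * (i.+1%:R / b%:R - i%:R / b%:R)%:E : \bar R)%E.
  by congr (_ * _)%E; exact: lE.
rewrite -EFinM -mulrBl mulrCA mulfV ?gt_eqF// mulr1 -natrB// subSnn.
by [].
Qed.

Lemma hist_ge0 b (w : 'I_b -> R) (x : Rb) :
  (forall i, 0 <= w i) -> 0 <= hist w x.
Proof.
by move=> w0; apply: sumr_ge0 => i _; rewrite mulr_ge0 ?bin_density_ge0.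
Qed.

Lemma measurable_hist b (w : 'I_b -> R) : measurable_fun setT (hist w).
Proof.
apply: measurable_sum => i; apply: measurable_funM => //.
exact: measurable_bin_density.
Qed.

Lemma hist_out b (w : 'I_b -> R) (x : Rb) : x \notin `[0, 1[%R -> hist w x = 0.
Proof.
move=> xN; rewrite /hist big1// => i _.
rewrite /bin_density indicE memNset ?mulr0//=.
have b0 : (0 : R) < b%:R by rewrite ltr0n; case: b w i => // w [].
move=> xi; move/negP: xN; apply; move: xi; rewrite !in_itv /= => /andP[h1 h2].
rewrite (le_trans _ h1) ?divr_ge0//= (lt_le_trans h2)//.
by rewrite ler_pdivrMr// mul1r ler_nat.
Qed.

Lemma integral_hist b (w : 'I_b -> R) : (forall i, 0 <= w i) ->
  (\int[leb]_x (hist w x)%:E = (\sum_i w i)%:E)%E.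
Proof.
move=> w0; rewrite /hist; under eq_integral do rewrite -sumEFin.
rewrite ge0_integral_sum//; last 2 first.
- move=> i; apply/measurable_EFinP; apply: measurable_funM => //.
  exact: measurable_bin_density.
- by move=> i x _; rewrite lee_fin mulr_ge0 ?bin_density_ge0.
rewrite -sumEFin; apply: eq_bigr => i _; under eq_integral do rewrite EFinM.
rewrite ge0_integralZl_EFin ?integral_bin_density ?mule1//.
- by move=> x _; rewrite lee_fin bin_density_ge0.
- by apply/measurable_EFinP; exact: measurable_bin_density.
Qed.

Context (d b : nat) (K : finType) (a : K -> R) (w : K -> 'I_d -> 'I_b -> R).

(** The index set [K] and the coefficients are arbitrary, so that this covers
    the Tucker histograms as well as the functions that dominate the difference
    of two of them. *)
Definition hist_mix (x : d.-tuple Rb) : R :=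
  \sum_s a s * \prod_(i < d) hist (w s i) (tnth x i).

Lemma measurable_hist_mix : measurable_fun setT hist_mix.
Proof.
apply: measurable_sum => s; apply: measurable_funM => //.
exact: (measurable_prod_tnth (g := fun i => hist (w s i))
  (fun i => measurable_hist (w s i))).
Qed.

Hypothesis a0 : forall s, 0 <= a s.
Hypothesis w0 : forall s i l, 0 <= w s i l.

Lemma hist_mix_ge0 x : 0 <= hist_mix x.
Proof.
apply: sumr_ge0 => s _; rewrite mulr_ge0// prodr_ge0// => i _.
exact: hist_ge0.
Qed.

Lemma integral_hist_mix :
  (\int[lebesgue_measure_d d]_x (hist_mix x)%:E =
   (\sum_s a s * \prod_(i < d) \sum_l w s i l)%:E)%E.
Proof.
have mP s : measurable_fun setT
    (fun x : d.-tuple Rb => \prod_(i < d) hist (w s i) (tnth x i)).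
  exact: (measurable_prod_tnth (g := fun i => hist (w s i))
  (fun i => measurable_hist (w s i))).
have P0 s (x : d.-tuple Rb) : 0 <= \prod_(i < d) hist (w s i) (tnth x i).
  by apply: prodr_ge0 => i _; exact: hist_ge0.
rewrite /hist_mix /lebesgue_measure_d; under eq_integral do rewrite -sumEFin.
rewrite ge0_integral_sum//; last 2 first.
- by move=> s; apply/measurable_EFinP; apply: measurable_funM.
- by move=> s x _; rewrite lee_fin mulr_ge0.
rewrite -sumEFin; apply: eq_bigr => s _; under eq_integral do rewrite EFinM.
rewrite ge0_integralZl_EFin//; last 2 first.
- by move=> x _; rewrite lee_fin.
- by apply/measurable_EFinP.
rewrite (integral_power_measure_prod (g := fun i => hist (w s i))
  (c := fun i => \sum_l w s i l))//.
- by move=> i; exact: measurable_hist.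
- by move=> i x; exact: hist_ge0.
- by move=> i; exact: integral_hist.
Qed.

(** Histograms vanish outside the unit interval, so the integral over the cube
    is the one over the whole space. *)
Lemma integral_hist_mix_cube :
  (\int[lebesgue_measure_d d]_(x in unit_cube d) (hist_mix x)%:E =
   (\sum_s a s * \prod_(i < d) \sum_l w s i l)%:E)%E.
Proof.
rewrite -integral_hist_mix integral_mkcond; apply: eq_integral => x _.
rewrite patchE; case: ifPn => // xN; rewrite /hist_mix big1// => s _.
move: xN; rewrite notin_setE => /existsNP[i /negP xi].
by rewrite (bigD1 i)//= hist_out// mul0r mulr0.
Qed.

End histogram_integrals.

(** * Tucker histograms *)

Section tucker_net.
Context {R : realType} (d b k : nat).
Local Notation Rb := (measurableTypeR R).
Local Notation tensor := ({ffun 'I_d -> 'I_k} -> R).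
Local Notation factors := ('I_d -> 'I_k -> 'I_b -> R).

Definition tucker (W : tensor) (w : factors) : d.-tuple Rb -> R :=
  hist_mix W (fun S i => w i (S i)).

Definition tucker_params (W : tensor) (w : factors) : Prop :=
  prob_tensors d k W /\ forall i j, simplex 'I_b (w i j).

Lemma tucker_histogramsP (f : d.-tuple Rb -> R) :
  tucker_histograms d b k f <->
  exists W w, tucker_params W w /\ f = tucker W w.
Proof.
split => [[W [p [simW hp ->]]]|[W [w [[simW simw] ->]]]]; last first.
  by exists W, (fun i j => hist (w i j)); split => // i j; exists (w i j).
have /choice[w hw] (ij : 'I_d * 'I_k) : exists w, simplex 'I_b w /\
    hist w = p ij.1 ij.2.
  by have [w sw wp] := hp ij.1 ij.2; exists w.
exists W, (fun i j => w (i, j)); split.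
  by split=> // i j; have [] := hw (i, j).
apply/funext => x; apply: eq_bigr => S _; congr (_ * _); apply: eq_bigr => i _.
by have [_ ->] := hw (i, S i).
Qed.

Section params.
Variables (W : tensor) (w : factors).
Hypothesis Ww : tucker_params W w.

Let W0 S : 0 <= W S. Proof. by case: Ww => [[]]. Qed.
Let w0 i j l : 0 <= w i j l. Proof. by case: Ww => _ /(_ i j)[]. Qed.

Lemma measurable_tucker : measurable_fun setT (tucker W w).
Proof. exact: measurable_hist_mix. Qed.

Lemma tucker_ge0 x : 0 <= tucker W w x.
Proof. by apply: hist_mix_ge0 => // S i; exact: w0. Qed.

Lemma integral_tucker :
  (\int[lebesgue_measure_d d]_(x in unit_cube d) (tucker W w x)%:E = 1)%E.
Proof.
rewrite integral_hist_mix_cube//.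
congr EFin; have [[_ W1] sw] := Ww; rewrite -[RHS]W1; apply: eq_bigr => S _.
by rewrite big1 ?mulr1// => i _; have [] := sw i (S i).
Qed.

End params.

(** The difference is dominated pointwise by mixtures of products of histograms
    with nonnegative weights, whose integrals are explicit: [G1] accounts for
    the change of the tensor and [G2], through [ler_prod_telescope], for the
    change of the factors. All factors of a product have integral one, except
    the one that is being replaced. *)
Lemma L1norm_tuckerB_le W w W' w' (r1 r2 : R) :
  tucker_params W w -> tucker_params W' w' ->
  (forall S, `|W S - W' S| <= r1) ->
  (forall i j l, `|w i j l - w' i j l| <= r2) ->
  (L1norm (tucker W w \- tucker W' w')%R <=
   ((k ^ d)%:R * r1 + d%:R * (b%:R * r2))%:E)%E.
Proof.
move=> Ww Ww' WW' ww'.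
have [[W0 W1] sw] := Ww; have [[W'0 W'1] sw'] := Ww'.
have w0 i j l : 0 <= w i j l by have [] := sw i j.
have w'0 i j l : 0 <= w' i j l by have [] := sw' i j.
have r10 S : 0 <= r1 := le_trans (normr_ge0 _) (WW' S).
have r20 i j l : 0 <= r2 := le_trans (normr_ge0 _) (ww' i j l).
pose t (Si : {ffun 'I_d -> 'I_k} * 'I_d) (j : 'I_d) : 'I_b -> R :=
  if (j < Si.2)%N then w j (Si.1 j)
  else if j == Si.2 then fun=> r2 else w' j (Si.1 j).
have t0 Si j l : 0 <= t Si j l.
  rewrite /t; case: ifP => // _; case: ifP => // _.
  exact: r20 j (Si.1 j) l.
pose G1 := hist_mix (fun _ : {ffun 'I_d -> 'I_k} => r1) (fun S i => w i (S i)).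
pose G2 := hist_mix (fun Si : {ffun 'I_d -> 'I_k} * 'I_d => W' Si.1) t.
have G10 x : 0 <= G1 x by apply: hist_mix_ge0 => // S i.
have G20 x : 0 <= G2 x by apply: hist_mix_ge0.
have bound x : `|tucker W w x - tucker W' w' x| <= G1 x + G2 x.
  rewrite /G2 /hist_mix -(pair_bigA _ (fun S i =>
    W' S * \prod_(j < d) hist (t (S, i) j) (tnth x j))) /=.
  rewrite -big_split /tucker /hist_mix -sumrB /=.
  rewrite (le_trans (ler_norm_sum _ _ _))//.
  apply: ler_sum => S _; set P := \prod_i _; set P' := \prod_i _.
  have P0 : 0 <= P by apply: prodr_ge0 => i _; apply: hist_ge0.
  rewrite (_ : _ - _ = (W S - W' S) * P + W' S * (P - P')); last by ring.
  rewrite (le_trans (ler_normD _ _))// !normrM (ger0_norm P0).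
  rewrite (ger0_norm (W'0 S)).
  rewrite lerD ?ler_wpM2r// -mulr_sumr ler_wpM2l//.
  apply: le_trans (ler_prod_telescope
    (e := fun i => hist (fun _ : 'I_b => r2) (tnth x i)) _ _ _) _.
  - by move=> i; exact: hist_ge0.
  - by move=> i; exact: hist_ge0.
  - move=> i; rewrite /hist -sumrB (le_trans (ler_norm_sum _ _ _))//.
    apply: ler_sum => l _.
    rewrite -mulrBl normrM [X in _ * X]ger0_norm ?bin_density_ge0//.
    by rewrite ler_wpM2r ?bin_density_ge0.
  - apply: ler_sum => i _; rewrite le_eqVlt; apply/orP; left; apply/eqP.
    apply: eq_bigr => j _; rewrite /t.
    by case: ifP => // _; case: ifP.
have mG1 : measurable_fun setT G1 by exact: measurable_hist_mix.
have mG2 : measurable_fun setT G2 by exact: measurable_hist_mix.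
have mU := @measurable_unit_cube R d.
rewrite /L1norm.
apply: (@le_trans _ _
    (\int[lebesgue_measure_d d]_(x in unit_cube d) (G1 x + G2 x)%:E)%E).
  apply: ge0_le_integral => //.
  - apply/measurable_EFinP; apply: measurableT_comp => //.
    apply: (measurable_funS measurableT) => //.
    by apply: measurable_funB; exact: measurable_tucker.
  - apply/measurable_EFinP; apply: (measurable_funS measurableT) => //.
    exact: measurable_funD.
  - by move=> x _; rewrite lee_fin bound.
under eq_integral do rewrite EFinD.
rewrite ge0_integralD//; last 4 first.
- by move=> x _; rewrite lee_fin.
- by apply/measurable_EFinP; apply: (measurable_funS measurableT).
- by move=> x _; rewrite lee_fin.
- by apply/measurable_EFinP; apply: (measurable_funS measurableT).
rewrite !integral_hist_mix_cube//.
rewrite -EFinD lee_fin lerD//.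
  rewrite le_eqVlt; apply/orP; left; apply/eqP.
  under eq_bigr => S _.
    rewrite big1; last by move=> i _; have [] := sw i (S i).
    over.
  by rewrite sumr_const mulr1 card_ffun !card_ord mulr_natl.
rewrite -(pair_bigA _ (fun S i => W' S * \prod_(j < d) \sum_l t (S, i) j l)) /=.
rewrite -[leRHS]mul1r -[X in _ <= X * _]W'1 mulr_suml ler_sum// => S _.
rewrite -mulr_sumr ler_wpM2l//.
rewrite (_ : d%:R * (b%:R * r2) = \sum_(i < d) b%:R * r2); last first.
  by rewrite sumr_const card_ord mulr_natl.
apply: ler_sum => i _; rewrite (bigD1 i)//= {1}/t /= ltnn eqxx.
rewrite sumr_const card_ord mulr_natl.
rewrite big1 ?mulr1// => j ji; rewrite /t /= (negbTE ji); case: ifP => _.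
  by have [] := sw j (S j).
by have [] := sw' j (S j).
Qed.

End tucker_net.


(** * A finite net of Tucker histograms *)

Lemma truncn_inord_close (R : archiRealFieldType) m (x y : R) : (0 < m)%N ->
  0 <= x <= 1 -> 0 <= y <= 1 ->
  inord (Num.truncn (m%:R * x)) = inord (Num.truncn (m%:R * y)) :> 'I_m.+1 ->
  `|x - y| <= m%:R^-1.
Proof.
move=> m0 /andP[x0 x1] /andP[y0 y1] /(congr1 (@nat_of_ord _)).
have mR : (0 : R) < m%:R by rewrite ltr0n.
have le (z : R) : 0 <= z -> z <= 1 -> (Num.truncn (m%:R * z) < m.+1)%N.
  move=> z0 z1; rewrite ltnS -(ler_nat R).
  apply: (@le_trans _ _ (m%:R * z)).
    by have /andP[] := truncn_itv (mulr_ge0 (ltW mR) z0).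
  by rewrite ler_piMr// ltW.
rewrite !inordK ?le// => E.
have /andP[h1 h2] := truncn_itv (mulr_ge0 (ltW mR) x0).
have /andP[h3 h4] := truncn_itv (mulr_ge0 (ltW mR) y0).
rewrite -(ler_pM2l mR) mulfV ?gt_eqF//.
rewrite -[X in X * `|_|]gtr0_norm// -normrM mulrBr.
rewrite ler_norml; move: h1 h2 h3 h4; rewrite E -!natr1; lra.
Qed.

Lemma simplex_uniform (R : realType) (I : finType) : (0 < #|I|)%N ->
  simplex I (fun=> #|I|%:R^-1 : R).
Proof.
move=> I0; split=> [i|]; first by rewrite invr_ge0.
by rewrite sumr_const -[_ *+ _]mulr_natr mulVf// pnatr_eq0 -lt0n.
Qed.

Lemma simplex_le1 (R : realType) (I : finType) (w : I -> R) i :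
  simplex I w -> 0 <= w i <= 1.
Proof.
move=> [w0 w1]; rewrite w0 -w1 (bigD1 i)//= lerDl.
by apply: sumr_ge0 => j _.
Qed.

(** The net consists of one parameter in every nonempty cell of a grid, so it
    is made of exact Tucker histograms and no rounding of weights within the
    simplex is involved. *)
Lemma ex_tucker_net (R : realType) (d b k m1 m2 : nat) :
  (0 < b)%N -> (0 < k)%N -> (0 < m1)%N -> (0 < m2)%N ->
  exists (I : finType) (W : I -> {ffun 'I_d -> 'I_k} -> R)
      (w : I -> 'I_d -> 'I_k -> 'I_b -> R),
    [/\ #|I| = (m2.+1 ^ (k ^ d) * m1.+1 ^ (d * k * b))%N,
      (forall c, tucker_params (W c) (w c)) &
      forall (W' : {ffun 'I_d -> 'I_k} -> R) (w' : 'I_d -> 'I_k -> 'I_b -> R),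
        tucker_params W' w' -> exists c,
        (L1norm (tucker W' w' \- tucker (W c) (w c))%R <=
         ((k ^ d)%:R * m2%:R^-1 + d%:R * (b%:R * m1%:R^-1))%:E)%E].
Proof.
move=> b0 k0 m10 m20.
pose P := (({ffun 'I_d -> 'I_k} -> R) * ('I_d -> 'I_k -> 'I_b -> R))%type.
pose I : finType := ({ffun {ffun 'I_d -> 'I_k} -> 'I_m2.+1} *
  {ffun 'I_d * 'I_k * 'I_b -> 'I_m1.+1})%type.
pose code (p : P) : I :=
  ([ffun S => inord (Num.truncn (m2%:R * p.1 S))],
   [ffun ijl => inord (Num.truncn (m1%:R * p.2 ijl.1.1 ijl.1.2 ijl.2))]).
pose good (p : P) := tucker_params p.1 p.2.
(* A default for the empty cells. *)
have [p0 gp0] : exists p, good p.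
  exists ((fun=> #|{: {ffun 'I_d -> 'I_k}}|%:R^-1),
          (fun _ _ _ => #|'I_b|%:R^-1)).
  split=> [|i j]; apply: simplex_uniform; rewrite ?card_ord//.
  by rewrite card_ffun !card_ord expn_gt0 k0.
have /choice[r rP] (c : I) : exists p, good p /\
    forall p', good p' -> code p' = c -> code p = c.
  have [[p [gp pc]]|no] := pselect (exists p, good p /\ code p = c).
    by exists p.
  by exists p0; split=> // p' gp' p'c; case: no; exists p'.
exists I, (fun c => (r c).1), (fun c => (r c).2); split.
- by rewrite /I card_prod !card_ffun !card_prod !card_ord.
- by move=> c; have [] := rP c.
move=> W' w' gp'; exists (code (W', w')).
have [gr /(_ (W', w') gp' erefl) rE] := rP (code (W', w')).
set p := r _ in gr rE *.
have [sW sw] := gp'; have [sW' sw'] := gr.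
apply: L1norm_tuckerB_le => // [S|i j l].
  apply: truncn_inord_close; [by []|exact: simplex_le1|exact: simplex_le1|].
  by move/(congr1 (fun c : I => c.1 S)): rE; rewrite /= !ffunE.
apply: truncn_inord_close; first by [].
- exact: (simplex_le1 l (sw i j)).
- exact: (simplex_le1 l (sw' i j)).
by move/(congr1 (fun c : I => c.2 (i, j, l))): rE; rewrite /= !ffunE.
Qed.

(** * Minimum distance selection over the net *)

Section densities.
Context {R : realType} (d : nat).
Local Notation Rb := (measurableTypeR R).
Local Notation mu := (power_measure (@lebesgue_measure R) d).
Local Notation cube := (@unit_cube R d).

Lemma densities_tucker b k (W : {ffun 'I_d -> 'I_k} -> R)
    (w : 'I_d -> 'I_k -> 'I_b -> R) :
  tucker_params W w -> densities d (tucker W w).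
Proof.
move=> Ww; split=> [|x _|].
- by apply: (measurable_funS measurableT) => //; exact: measurable_tucker.
- exact: tucker_ge0.
- exact: integral_tucker.
Qed.

Lemma integrable_densities (p : d.-tuple Rb -> R) : densities d p ->
  mu.-integrable cube (EFin \o p).
Proof.
move=> [mp p0 p1]; apply/integrableP; split; first by apply/measurable_EFinP.
apply: (@le_lt_trans _ _ 1%E); last exact: ltry.
rewrite -p1 le_eqVlt; apply/orP; left; apply/eqP; apply: eq_integral => x.
by rewrite inE => Dx; rewrite /= ger0_norm// p0.
Qed.

Lemma Rintegral_densities (p : d.-tuple Rb -> R) : densities d p ->
  \int[mu]_(x in cube) p x = 1.
Proof. by move=> [_ _ p1]; exact: (congr1 fine p1). Qed.

Lemma L1norm_distE (f g : d.-tuple Rb -> R) :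
  mu.-integrable cube (EFin \o f) -> mu.-integrable cube (EFin \o g) ->
  L1norm (f \- g) = (\int[mu]_(x in cube) `|f x - g x|)%:E.
Proof.
move=> fi gi; rewrite /Rintegral fineK//; apply: integrable_fin_num.
  exact: measurable_unit_cube.
apply: integrable_norm.
exact: (integrableB (@measurable_unit_cube R d) fi gi).
Qed.

Lemma density_law_subset (p : d.-tuple Rb -> R) (A : set (d.-tuple Rb)) :
  A `<=` cube -> fine (density_law p A) = \int[mu]_(x in A) p x.
Proof. by move=> AD; rewrite /density_law setIidl. Qed.

End densities.

Lemma lee_ereal_inf_affine (R : realType) (S : set (\bar R)) (c r e : R) :
  0 < c ->
  (forall y, S y -> (r%:E <= c%:E * y + e%:E)%E) ->
  (r%:E <= c%:E * ereal_inf S + e%:E)%E.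
Proof.
move=> c0 rS.
have : (((r - e) / c)%:E <= ereal_inf S)%E.
  apply: le_ereal_inf_tmp => y /rS; case: y => [y||].
  - by rewrite -EFinM -EFinD !lee_fin ler_pdivrMr// mulrC lerBlDr.
  - by rewrite leey.
  - by rewrite mulrNy gtr0_sg// mul1e.
case: (ereal_inf S) => [y||].
- by rewrite -EFinM -EFinD !lee_fin ler_pdivrMr// mulrC lerBlDr.
- by move=> _; rewrite gt0_muley ?lte_fin// addye// leey.
- by [].
Qed.

(** The sizes [b ^ 2] and [(k ^ d) ^ 2] of the grids are the polynomial choice
    that makes the radius of the net vanish at the cost of a constant factor
    in the logarithm of its size. *)
Definition net_size (d b k : nat) : nat :=
  ((k ^ d) ^ 2).+1 ^ (k ^ d) * (b ^ 2).+1 ^ (d * k * b).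

Definition net_radius (R : realType) (d b k : nat) : R :=
  (k ^ d)%:R * ((k ^ d) ^ 2)%N%:R^-1 + d%:R * (b%:R * (b ^ 2)%N%:R^-1).

Section tucker_estimator.
Context {R : realType} (d b k n : nat).
Local Notation Rb := (measurableTypeR R).
Local Notation cube := (@unit_cube R d).

Definition uniform_tail
    (V : n.-tuple (d.-tuple Rb) -> d.-tuple Rb -> R) : Prop :=
  forall (p : d.-tuple Rb -> R) (e eps : R), densities d p -> 0 < e <= 2 ->
    3 * net_radius R d b k + 4 * e <= eps ->
    (sample_law p n
      [set X | (L1norm (V X \- p)%R >
                3%:E * L1dist p (tucker_histograms d b k) + eps%:E)%E] <=
    ((net_size d b k * net_size d b k)%:R *
     (2 * expR (- (n%:R * (e ^+ 2 / 8)))))%:E)%E.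

Hypotheses (b_gt0 : (0 < b)%N) (k_gt0 : (0 < k)%N) (n_gt0 : (0 < n)%N).

(** The minimum distance estimator over the net. The sample is good when all
    empirical frequencies are within [e] of their probabilities; then, for
    every Tucker histogram [f], the comparison with the point of the net
    nearest to [f] costs three times the radius of the net. *)
Lemma ex_tucker_estimator :
  exists V : n.-tuple (d.-tuple Rb) -> d.-tuple Rb -> R,
    estimator (tucker_histograms d b k) V /\
    uniform_tail V.
Proof.
have m1_gt0 : (0 < b ^ 2)%N by rewrite expn_gt0 b_gt0.
have m2_gt0 : (0 < (k ^ d) ^ 2)%N by rewrite !expn_gt0 k_gt0.
have [I [W [w [cardI Ww net]]]] := ex_tucker_net R d b_gt0 k_gt0 m1_gt0 m2_gt0.
rewrite -/(net_size d b k) in cardI; rewrite -/(net_radius R d b k) in net.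
have i0 : I.
  suff : (0 < #|I|)%N by move=> /card_gt0P/cid[].
  by rewrite cardI /net_size muln_gt0 !expn_gt0.
pose mu : {measure set (d.-tuple Rb) -> \bar R} :=
  power_measure (@lebesgue_measure R) d.
have mU : measurable cube by exact: measurable_unit_cube.
pose q i := tucker (W i) (w i).
have mq i : measurable_fun setT (q i) by exact: measurable_tucker.
have dq i : densities d (q i) by exact: densities_tucker.
have qi i : mu.-integrable cube (EFin \o q i) by exact: integrable_densities.
have q1 i : \int[mu]_(x in cube) q i x = 1 by exact: Rintegral_densities.
pose A := yatracos cube q.
have mA jl : measurable (A jl) by exact: measurable_yatracos.
pose sel (nu : I * I -> R) := min_distance mu cube q i0 nu.
exists (fun X => q (sel (empirical R A X))); split.
  split=> [X|]; last exact: measurable_selected.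
  apply/tucker_histogramsP; set i := sel _.
  by exists (W i), (w i).
move=> p e eps dp e02 etae.
have pi : mu.-integrable cube (EFin \o p) by exact: integrable_densities.
have p1 : \int[mu]_(x in cube) p x = 1 by exact: Rintegral_densities.
have [Q QE] := density_lawE d p dp.
rewrite /sample_law QE.
have := empirical_deviation mA Q n_gt0 e02.
rewrite card_prod cardI; apply: le_trans.
apply: le_measure; rewrite ?inE.
- exact: (measurable_empirical mA (fun nu =>
    (3%:E * L1dist p (tucker_histograms d b k) + eps%:E <
     L1norm (q (sel nu) \- p)%R)%E)).
- exact: (measurable_empirical mA
    (fun nu => ~ forall j, `| fine (Q (A j)) - nu j | <= e)).
move=> X /= far close; move: far; apply/negP; rewrite -leNgt.
rewrite (L1norm_distE (qi _) pi).
apply: lee_ereal_inf_affine => //.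
move=> _ [f /tucker_histogramsP[W' [w' [Ww' ->]]] <-].
have fi : mu.-integrable cube (EFin \o tucker W' w').
  by apply: integrable_densities; exact: densities_tucker.
have [c] := net _ _ Ww'.
rewrite (L1norm_distE fi (qi c)) (L1norm_distE pi fi).
rewrite lee_fin -EFinM -EFinD lee_fin => hc.
have pnu jl :
    `| \int[mu]_(x in yatracos cube q jl) p x - empirical R A X jl | <= e.
  by rewrite -density_law_subset ?QE//; exact: subIsetl.
have := min_distance_le mU mq qi q1 i0 c pi p1 pnu.
have := Rintegral_dist_triangle mU (qi c) fi pi.
have distC (g h : d.-tuple Rb -> R) :
    \int[mu]_(x in cube) `|g x - h x| = \int[mu]_(x in cube) `|h x - g x|.
  by apply: eq_Rintegral => x _; exact: distrC.
rewrite (distC (q c) (tucker W' w')) (distC (tucker W' w') p) -/(sel _).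
move: hc etae; rewrite -/mu; lra.
Qed.

End tucker_estimator.

(** * Growth of the net and consistency *)

Lemma ex_density (R : realType) d :
  exists p : d.-tuple (measurableTypeR R) -> R, densities d p.
Proof.
exists (@tucker R d 1 1 (fun=> #|{: {ffun 'I_d -> 'I_1}}|%:R^-1)
  (fun _ _ _ => #|'I_1|%:R^-1)).
apply: densities_tucker.
split=> [|i j]; apply: simplex_uniform; rewrite ?card_ord//.
by rewrite card_ffun !card_ord exp1n.
Qed.

Lemma natr_exp_sqrS_le (R : realType) (x e : nat) : (1 < x)%N ->
  (((x ^ 2).+1 ^ e)%N%:R : R) <= expR (3 * (e%:R * ln x%:R)).
Proof.
move=> x1.
have xR : (0 : R) < x%:R by rewrite ltr0n ltnW.
rewrite natrX (_ : 3 * _ = e%:R * (3%:R * ln x%:R)); last by ring.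
rewrite !expRM_natl lnK ?posrE// lerXn2r ?nnegrE// ?exprn_ge0 ?(ltW xR)//.
rewrite -natrX ler_nat.
have -> : (x ^ 3 = x ^ 2 * x)%N by rewrite -expnSr.
apply: (@leq_trans (x ^ 2 * 2)); last by rewrite leq_mul2l x1 orbT.
by rewrite muln2 -addnn -addn1 leq_add2l expn_gt0 ltnW.
Qed.

(** Since [x ^ 2 + 1 <= x ^ 3], the net has size at most [exp (3 d Den)]. So
    the bound is at most [2 exp (6 d Den - n c)], and the hypothesis says that
    [6 d Den] is at most half of [n c]. *)
Lemma net_size_tail (R : realType) (d b k n : nat) (c : R) :
  let K := (k ^ d)%N in
  let N := net_size d b k in
  let Den := (b * k)%:R * ln (b%:R : R) + K%:R * ln (K%:R : R) in
  (0 < d)%N -> (1 < b)%N -> (1 < k)%N -> 0 < c ->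
  12 * d%:R / c <= n%:R / Den ->
  (N * N)%:R * (2 * expR (- (n%:R * c))) <= geometric 2 (expR (- (c / 2))) n.
Proof.
move=> K N Den d0 b1 k1 c0 cn.
have dR : (1 : R) <= d%:R by rewrite ler1n.
have K1 : (1 < K)%N by rewrite -(exp1n d) ltn_exp2r.
have lnb0 : (0 : R) <= ln b%:R by rewrite ln_ge0// ler1n ltnW.
have lnK0 : (0 : R) <= ln K%:R by rewrite ln_ge0// ler1n ltnW.
have Den0 : 0 <= Den by rewrite addr_ge0// mulr_ge0.
have M0 : 0 < 12 * d%:R / c by rewrite divr_gt0// mulr_gt0// (lt_le_trans _ dR).
have {}Den0 : 0 < Den.
  (* A zero denominator would make the quotient zero. *)
  rewrite lt0r Den0 andbT; apply/eqP => D0.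
  by move: cn; rewrite D0 invr0 mulr0; lra.
have Dn : 12 * d%:R * Den <= n%:R * c.
  by move: cn; rewrite ler_pdivlMr// mulrAC ler_pdivrMr.
have NE : N%:R <= expR (3 * (d%:R * Den)) :> R.
  rewrite /N /net_size natrM.
  apply: (le_trans (ler_pM _ _ (natr_exp_sqrS_le R K K1)
    (natr_exp_sqrS_le R (d * k * b) b1))) => //.
  rewrite -expRD ler_expR -mulrDr ler_wpM2l// /Den mulrDr addrC lerD//.
    by rewrite mulrA -natrM mulnA mulnAC.
  by rewrite ler_peMl// mulr_ge0.
rewrite /geometric /= mulrCA ler_wpM2l// -expRM_natl natrM.
apply: (@le_trans _ _ (expR (3 * (d%:R * Den)) * expR (3 * (d%:R * Den)) *
    expR (- (n%:R * c)))).
  by rewrite ler_wpM2r ?expR_ge0// ler_pM.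
rewrite -!expRD ler_expR; lra.
Qed.

Lemma net_radius_le (R : realType) (d b k A : nat) :
  (0 < d)%N -> (0 < A)%N -> (A <= b)%N -> (A <= k)%N ->
  net_radius R d b k <= (1 + d%:R) / A%:R.
Proof.
move=> d0 A0 Ab Ak.
have inv (x : nat) : (A <= x)%N -> x%:R * (x ^ 2)%:R^-1 <= A%:R^-1 :> R.
  move=> Ax; have x0 : (0 : R) < x%:R by rewrite ltr0n (leq_trans A0).
  rewrite natrX expr2 invfM mulrA mulfV ?gt_eqF// mul1r.
  by rewrite lef_pV2 ?posrE// ?ltr0n// ler_nat.
have AK : (A <= k ^ d)%N.
  rewrite (leq_trans Ak)//; have : (0 < k)%N by rewrite (leq_trans A0).
  case: k {Ak} => // -[|k'] _; rewrite ?exp1n//.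
  by rewrite -[X in (X <= _)%N]expn1 leq_exp2l.
by rewrite mulrDl mul1r lerD ?inv// ler_wpM2l ?inv.
Qed.

Theorem theorem2p2 (R : realType) (d : nat) (d_gt0 : (0 < d)%N)
    (b k : nat -> nat)
    (b_gt0 : forall n, (0 < n)%N -> (0 < b n)%N)
    (k_gt0 : forall n, (0 < n)%N -> (0 < k n)%N)
    (b_oo : b n @[n --> \oo] --> \oo)
    (k_oo : k n @[n --> \oo] --> \oo)
    (rate : n%:R / ((b n * k n)%:R * ln ((b n)%:R : R) +
                    (k n ^ d)%:R * ln ((k n ^ d)%:R : R))
            @[n --> \oo] --> +oo) :
  exists V : forall n, n.-tuple (d.-tuple (measurableTypeR R)) ->
               d.-tuple (measurableTypeR R) -> R,
    (forall n, (0 < n)%N -> estimator (tucker_histograms d (b n) (k n)) (V n)) /\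
    (forall eps : R, 0 < eps ->
      ereal_sup
        [set sample_law p n
               [set X | (L1norm (V n X \- p)%R >
                         3%:E * L1dist p (tucker_histograms d (b n) (k n)) +
                         eps%:E)%E]
        | p in densities d]
      @[n --> \oo] --> 0%E).
Proof.
(* At n = 0, where b n and k n may vanish, V is arbitrary. *)
have exV n : {V : n.-tuple (d.-tuple (measurableTypeR R)) ->
      d.-tuple (measurableTypeR R) -> R | (0 < n)%N ->
    estimator (tucker_histograms d (b n) (k n)) V /\
    uniform_tail (b n) (k n) V}.
  apply: cid; case: (posnP n) => [->|n0]; first by exists (fun _ _ => 0).
  have [V HV] := @ex_tucker_estimator R d _ _ _ (b_gt0 n n0) (k_gt0 n n0) n0.
  by exists V.
exists (fun n => sval (exV n)); split=> [n n0|eps eps0].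
  by have [] := svalP (exV n) n0.
(* Half of eps is spent on 4 e and half on three times the net radius. *)
pose e := Num.min 1 (eps / 8).
have e0 : 0 < e by rewrite lt_min ltr01/= divr_gt0.
have e1 : e <= 1 by rewrite ge_min lexx.
have ee : e <= eps / 8 by rewrite ge_min lexx orbT.
have c0 : 0 < e ^+ 2 / 8 by rewrite divr_gt0// exprn_gt0.
(* A lower bound for b n and k n: it makes the net radius at most eps / 6, and
   being at least 2 it allows x ^ 2 + 1 <= x ^ 3. *)
pose A := (Num.truncn ((1 + d%:R) * 6 / eps)).+2.
apply: (@squeeze_cvge _ _ _ _ (fun=> 0%E) _
   (fun n => (geometric 2 (expR (- (e ^+ 2 / 8 / 2))) n)%:E)); last 2 first.
- exact: cvg_cst.
- apply: cvg_EFin; first exact: nearW.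
  apply: cvg_geometric; rewrite ger0_norm ?expR_ge0// expR_lt1; lra.
near=> n; apply/andP; split.
  (* The supremum of the empty set is -oo, hence a density is exhibited. *)
  have [p dp] := ex_density R d.
  apply: ereal_sup_ge; eexists; first by exists p.
  have [Q QE] := density_lawE d p dp.
  by rewrite /sample_law QE; exact: measure_ge0.
have n0 : (0 < n)%N by near: n; exists 1%N.
have bA : (A <= b n)%N by near: n; move/cvgnyPge: b_oo; apply.
have kA : (A <= k n)%N by near: n; move/cvgnyPge: k_oo; apply.
have rateA : 12 * d%:R / (e ^+ 2 / 8) <=
    n%:R / ((b n * k n)%:R * ln ((b n)%:R : R) +
            (k n ^ d)%:R * ln ((k n ^ d)%:R : R)).
  by near: n; move/cvgryPge: rate; apply.
apply: ge_ereal_sup => _ [p dp <-].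
have [_ tail] := svalP (exV n) n0.
apply: le_trans (tail p e eps dp _ _) _.
- by rewrite e0/=; lra.
- have AR : (1 + d%:R) * 6 / eps <= A%:R.
    by rewrite (le_trans (ltW (truncnS_gt _)))// ler_nat.
  have A0 : (0 : R) < A%:R by rewrite ltr0n.
  have := net_radius_le R d_gt0 (isT : (0 < A)%N) bA kA.
  have : (1 + d%:R) / A%:R <= eps / 6.
    by move: AR; rewrite !ler_pdivrMr// => AR; lra.
  lra.
- rewrite lee_fin; apply: net_size_tail => //.
  + exact: leq_trans bA.
  + exact: leq_trans kA.
Unshelve. all: by end_near.
Qed.
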